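(* For every $n$ and $L$, consider the family of $n$-vertex planar graphs (with edge weights) in which, for every ordered pair of vertices, the number of distinct shortest paths between them can be written with at most $L$ bits. Any labeling scheme that assigns a bit-string label to each vertex of each graph in this family such that, for every pair of vertices $s,t$, the number of distinct shortest $s$-to-$t$ paths can be computed from the labels of $s$ and $t$ alone, must use labels of $\Omega(\sqrt{nL})$ bits on some graph of the family.
   Context: Label size is measured in bits; the lower bound concerns the maximum label length over all vertices of all graphs in the family.
   Formalization: Proved for n ≥ 2 and 2 ≤ L ≤ K·n, K any fixed constant (the Ω-constant depends on K): the bound fails for n = 1, for L = 1 (O(log n)-bit component labels suffice) and for L far above n (simple planar graphs have at most 2^(3n) shortest paths per pair); for L = 0 the family is empty. *)

(* Defs.v *)
From HB Require Import structures.
From mathcomp Require Import all_boot all_order all_algebra.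
From mathcomp Require Import all_classical all_reals all_analysis.

Set Implicit Arguments.
Unset Strict Implicit.
Unset Printing Implicit Defensive.

Import Order.TTheory GRing.Theory Num.Theory.
Import numFieldNormedType.Exports.

Local Open Scope classical_set_scope.
Local Open Scope ring_scope.

(* Finite simple undirected graph on n vertices with positive edge weights;
   the values of [wt] on non-adjacent pairs carry no meaning. *)
Record wgraph (R : realType) (n : nat) := WGraph {
  adj : rel 'I_n;
  wt : 'I_n -> 'I_n -> R;
  adj_sym : symmetric adj;
  adj_irr : irreflexive adj;
  wt_sym : forall u v, wt u v = wt v u;
  wt_gt0 : forall u v, adj u v -> 0 < wt u v
}.

(* Each edge {u, v} is represented once, by its pair (u, v) with u < v. *)
Definition edge (R : realType) (n : nat) (G : wgraph R n) (u v : 'I_n) : bool :=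
  adj G u v && (u < v)%N.

(* Vertices are drawn at the points [pos], the edge {u, v} with u < v as the
   simple arc [arc u v] parametrized by [0, 1]. *)
Record plane_drawing (R : realType) (n : nat) (G : wgraph R n)
    (pos : 'I_n -> R * R) (arc : 'I_n -> 'I_n -> R -> R * R) : Prop := {
  pos_inj : injective pos;
  arc_continuous : forall u v, edge G u v ->
    {within `[0, 1], continuous (arc u v)};
  arc_inj : forall u v, edge G u v -> {in `[0, 1] &, injective (arc u v)};
  arc_source : forall u v, edge G u v -> arc u v 0 = pos u;
  arc_target : forall u v, edge G u v -> arc u v 1 = pos v;
  arc_avoids_vertices : forall u v x (a : R), edge G u v ->
    a \in `]0, 1[ -> arc u v a <> pos x;
  arcs_do_not_cross : forall u v u' v' (a b : R),
    edge G u v -> edge G u' v' ->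
    (u, v) <> (u', v') -> a \in `]0, 1[ -> b \in `]0, 1[ ->
    arc u v a <> arc u' v' b
}.

Definition planar (R : realType) (n : nat) (G : wgraph R n) : Prop :=
  exists pos arc, plane_drawing G pos arc.

(* A path from s is given by the sequence p of the vertices following s. *)
Definition is_path (R : realType) (n : nat) (G : wgraph R n) (s t : 'I_n)
    (p : seq 'I_n) : bool :=
  [&& path (adj G) s p, uniq (s :: p) & last s p == t].

Definition path_weight (R : realType) (n : nat) (G : wgraph R n) (s : 'I_n)
    (p : seq 'I_n) : R :=
  \sum_(e <- zip (s :: p) p) wt G e.1 e.2.

(* A path of G has at most n vertices, so the sequences of length at most n
   (the finite type [n.-bseq 'I_n]) account for all of them. *)
Definition is_shortest_path (R : realType) (n : nat) (G : wgraph R n)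
    (s t : 'I_n) (p : n.-bseq 'I_n) : bool :=
  is_path G s t p &&
  [forall q : n.-bseq 'I_n,
     is_path G s t q ==> (path_weight G s p <= path_weight G s q)].

Definition num_shortest_paths (R : realType) (n : nat) (G : wgraph R n)
    (s t : 'I_n) : nat :=
  #|[set p : n.-bseq 'I_n | is_shortest_path G s t p]%SET|.

(* k can be written with at most L bits iff k < 2 ^ L. *)
Definition bounded_count_planar (R : realType) (n L : nat) (G : wgraph R n) : Prop :=
  planar G /\ forall s t : 'I_n, (num_shortest_paths G s t < 2 ^ L)%N.

(* The decoder sees nothing but the two labels; as [n] and [L] are fixed, it
   may depend on them. *)
Definition counting_scheme (R : realType) (n L : nat)
    (label : wgraph R n -> 'I_n -> seq bool)
    (decode : seq bool -> seq bool -> nat) : Prop :=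
  forall G : wgraph R n, bounded_count_planar L G ->
  forall s t : 'I_n,
    decode (label G s) (label G t) = num_shortest_paths G s t.

(* Main.v *)
(* The hard graphs are k-column grids of cells.  Horizontal edges get longer
   from row to row and vertical edges are longer than any row, so a shortest
   path from a vertex t down to a vertex s runs horizontally in the row of t and
   then straight down the column of s.  It turns at the upper right corner, and
   there it is cheaper to cut through the preceding cell: a strip of triangles
   hangs in the cell, whose x-th even vertex is reached in 2 ^ x ways and is
   joined to the lower right corner of the cell if and only if the bit
   b i j x is set.  With edge lengths making all these short cuts tie, the
   number of shortest paths from (i, 0) to (q, j + 1) is, up to an additive
   constant, the number with binary digits b i j x.  Hence 2q labels determine
   q ^ 2 * l bits and some label has about q * l / 2 bits, where l is of order L
   and q ^ 2 * l is of order n.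

   The counts for all pairs of vertices are found exactly from an explicit
   distance function: shortest paths are the walks along which it drops at full
   speed.  They stay below 2 ^ (3 * l - 1), because a shortest path crosses one
   full strip and parts of two others at most. *)

Require Import Defs.
From mathcomp Require Import all_boot all_order all_algebra.
From mathcomp Require Import all_classical all_reals all_analysis.
From mathcomp Require Import zify ring lra.

Import Order.TTheory GRing.Theory Num.Theory.
Import numFieldNormedType.Exports.
Local Open Scope ring_scope.

(** * Counting shortest paths with a potential *)

Section ShortestPaths.
Variables (R : realType) (n : nat) (G : wgraph R n).
Implicit Types (s t u v : 'I_n) (p q : seq 'I_n).

Lemma path_weight_nil s : path_weight G s [::] = 0.
Proof. by rewrite /path_weight /= big_nil. Qed.

Lemma path_weight_cons s u p :
  path_weight G s (u :: p) = wt G s u + path_weight G u p.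
Proof. by rewrite /path_weight /= big_cons. Qed.

Lemma path_weight_rcons s p u :
  path_weight G s (rcons p u) = path_weight G s p + wt G (last s p) u.
Proof.
elim: p s => [|v p IHp] s /=.
  by rewrite path_weight_cons !path_weight_nil addr0 add0r.
by rewrite !path_weight_cons IHp addrA.
Qed.

Lemma last_rev_belast s p : last (last s p) (rev (belast s p)) = s.
Proof. by case: p => //= u p; rewrite rev_cons last_rcons. Qed.

Lemma path_weight_rev s p :
  path_weight G (last s p) (rev (belast s p)) = path_weight G s p.
Proof.
elim: p s => [|v p IHp] s /=; first by rewrite !path_weight_nil.
by rewrite rev_cons path_weight_rcons last_rev_belast IHp path_weight_cons
  wt_sym addrC.
Qed.

Lemma is_path_rev s t p : is_path G s t p -> is_path G t s (rev (belast s p)).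
Proof.
case/and3P=> pP pU /eqP lastp; rewrite /is_path -lastp last_rev_belast eqxx.
rewrite rev_path (eq_path (e' := adj G)) ?pP /=; last by move=> ? ?; rewrite adj_sym.
by rewrite andbT mem_rev rev_uniq -rcons_uniq -lastI.
Qed.

Lemma is_shortest_path_rev s t (p : n.-bseq 'I_n) :
  is_shortest_path G s t p ->
  exists2 q : n.-bseq 'I_n, q = rev (belast s p) :> seq _ & is_shortest_path G t s q.
Proof.
case/andP=> pP /forallP p_min.
have sz_rev x (q : n.-bseq 'I_n) : (size (rev (belast x q)) <= n)%N.
  by rewrite size_rev size_belast size_bseq.
exists (Bseq (sz_rev s p)) => //; rewrite /is_shortest_path /= is_path_rev //=.
apply/forallP=> q; apply/implyP=> qP.
have /implyP/(_ (is_path_rev _ _ _ qP)) := p_min (Bseq (sz_rev t q)).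
have lastp : last s p = t by case/and3P: pP => _ _ /eqP.
have lastq : last t q = s by case/and3P: qP => _ _ /eqP.
have -> : path_weight G t (rev (belast s p)) = path_weight G s p.
  by rewrite -lastp path_weight_rev.
suff -> : path_weight G s (Bseq (sz_rev t q)) = path_weight G t q by [].
by rewrite /= -{1}lastq path_weight_rev.
Qed.

(** Counts are later found only towards targets whose row index is at most that of the source; this
    covers the other pairs. *)
Lemma num_shortest_paths_sym s t :
  num_shortest_paths G s t = num_shortest_paths G t s.
Proof.
suff le x y : (num_shortest_paths G x y <= num_shortest_paths G y x)%N.
  by apply/eqP; rewrite eqn_leq !le.
pose r (p : n.-bseq 'I_n) : n.-bseq 'I_n := insub_bseq n (rev (belast x p)).
have rE (p : n.-bseq 'I_n) : r p = rev (belast x p) :> seq _.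
  rewrite /r /insub_bseq val_insubd /= size_rev size_belast.
  by rewrite size_bseq.
rewrite /num_shortest_paths -(card_in_imset (f := r)) => [|p q].
  apply/subset_leq_card/fintype.subsetP=> _ /imsetP[p + ->]; rewrite !inE.
  move=> /is_shortest_path_rev[q qE]; congr (is_shortest_path _ _ _ _).
  by apply: val_inj; rewrite /= rE.
rewrite !inE => /andP[/and3P[_ _ /eqP lastp] _] /andP[/and3P[_ _ /eqP lastq] _].
move/(congr1 val); rewrite /= !rE => /(inv_inj revK) eq_belast.
apply: val_inj => /=; suff [] : x :: p = x :: q by [].
by rewrite !lastI eq_belast lastp lastq.
Qed.

(* A potential [D] that is 1-Lipschitz for the edge lengths bounds distances
   from below, and the walks using only tight edges are exactly the paths
   attaining the bound; [F] counts these by recursion on the first step. *)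
Variables (t0 : 'I_n) (w : 'I_n -> 'I_n -> nat) (D F : 'I_n -> nat).
Hypothesis wE : forall u v, adj G u v -> wt G u v = (w u v)%:R.
Hypothesis D_lip : forall u v, adj G u v -> (D u <= D v + w u v)%N.

Let tight u v := adj G u v && (D u == D v + w u v)%N.

Hypothesis F_target : F t0 = 1%N.
Hypothesis F_rec : forall u, u != t0 -> F u = (\sum_(v | tight u v) F v)%N.

Let tight_lt u v : tight u v -> (D v < D u)%N.
Proof.
case/andP=> uv /eqP ->; rewrite -[X in (X < _)%N]addn0 ltn_add2l.
by have := wt_gt0 uv; rewrite wE // ltr0n.
Qed.

Let tight_path_le s p : path tight s p -> (D (last s p) <= D s)%N.
Proof.
elim: p s => //= u p IHp s /andP[/tight_lt su /IHp] h.
exact: leq_trans h (ltnW su).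
Qed.

Let tight_path_uniq s p : path tight s p -> uniq (s :: p).
Proof.
have tr : transitive (fun u v => D v < D u)%N.
  by move=> y x z xy yz; apply: ltn_trans yz xy.
move=> sp; have : path (fun u v => D v < D u)%N s p.
  by apply: sub_path sp => u v /tight_lt.
move=> sp'; apply: (sorted_uniq tr); last exact: sp'.
by move=> u; rewrite ltnn.
Qed.

Let path_weight_ge s p : path (adj G) s p ->
  (D s)%:R <= (D (last s p))%:R + path_weight G s p.
Proof.
elim: p s => [|u p IHp] s /=; first by rewrite path_weight_nil addr0.
case/andP=> su /IHp IH; rewrite path_weight_cons wE //.
have : ((D s)%:R <= (D u)%:R + (w s u)%:R :> R) by rewrite -natrD ler_nat D_lip.
by move: IH; lra.
Qed.

Let path_weight_tight s p : path (adj G) s p ->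
  ((D s)%:R == (D (last s p))%:R + path_weight G s p) = path tight s p.
Proof.
elim: p s => [|u p IHp] s /=; first by rewrite path_weight_nil addr0 eqxx.
case/andP=> su up; rewrite -IHp // path_weight_cons wE // /tight su /=.
rewrite -(eqr_nat R) natrD.
have := path_weight_ge _ _ up.
have : ((D s)%:R <= (D u)%:R + (w s u)%:R :> R) by rewrite -natrD ler_nat D_lip.
move=> h1 h2; apply/eqP/andP => [h3|[/eqP h3 /eqP h4]]; last by lra.
by split; apply/eqP; lra.
Qed.

(** Strong induction on [D s], which drops along tight edges: a tight walk splits uniquely into its
    first step and a tight walk from there. *)
Let tight_walks s : exists ps : seq (seq 'I_n),
  [/\ uniq ps, size ps = F s &
      forall p, (p \in ps) = path tight s p && (last s p == t0)].
Proof.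
have [N] := ubnP (D s); elim: N s => // N IHN s /ltnSE leN.
case: (eqVneq s t0) => [->|s_t].
  exists [:: [::]]; rewrite F_target; split=> // -[|u p] /=.
    by rewrite ?inE ?eqxx.
  rewrite inE /=; apply/esym/negP => /andP[/andP[/tight_lt tu up] /eqP lt].
  by have := tight_path_le _ _ up; rewrite lt leqNgt tu.
suff [pss [U sz memP]] : exists pss : 'I_n -> seq (seq 'I_n),
  [/\ forall u, tight s u -> uniq (pss u), forall u, tight s u -> size (pss u) = F u &
   forall u p, tight s u -> (p \in pss u) = path tight u p && (last u p == t0)].
  exists [seq u :: p | u <- enum (tight s), p <- pss u]; split.
  - apply: allpairs_uniq_dep; rewrite ?enum_uniq //.
      by move=> u; rewrite mem_enum; apply: U.
    by move=> [u p] [v q] _ _ /= [-> ->].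
  - rewrite size_allpairs_dep F_rec // sumnE big_map big_enum /=.
    exact: eq_bigr.
  move=> p; apply/allpairsPdep/idP => [[u [q [su uq ->]]]|].
    by move: su uq; rewrite mem_enum => su; rewrite memP //= (su : tight s u).
  case: p => [|u q] /=; first by rewrite (negPf s_t).
  move=> /andP[/andP[su uq] lq]; exists u, q; rewrite mem_enum memP //.
  by rewrite uq lq.
have /fin_all_exists[f fP] u : exists ps, tight s u -> [/\ uniq ps, size ps = F u &
      forall p, (p \in ps) = path tight u p && (last u p == t0)].
  case su: (tight s u); last by exists [::].
  by have [ps] := IHN u (leq_trans (tight_lt _ _ su) leN); exists ps.
by exists f; split=> u => [su|su|p su]; have [] := fP u su.
Qed.

(** Positivity of [F s] provides a tight walk, so the lower bound [D s - D t0] is attained, and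
    exactly by the tight walks. *)
Lemma num_shortest_paths_potential s :
  (0 < F s)%N -> num_shortest_paths G s t0 = F s.
Proof.
have [ps [ps_uniq <- psE]] := tight_walks s => ps_gt0.
have ltn_size p : uniq p -> (size p <= n)%N.
  by move=> /card_uniqP <-; rewrite -[X in (_ <= X)%N]card_ord max_card.
have tightP p : path tight s p -> last s p = t0 ->
    is_path G s t0 p /\ (size p <= n)%N.
  move=> sp lp; have U := tight_path_uniq _ _ sp.
  rewrite /is_path U lp eqxx (sub_path _ sp); last by move=> ? ? /andP[].
  by split=> //; apply: ltn_size; case/andP: U.
have shortE (p : n.-bseq 'I_n) : is_shortest_path G s t0 p = ((p : seq _) \in ps).
  rewrite psE; apply/andP/andP => [[pP /forallP p_min]|[sp /eqP lp]].
    case: ps psE ps_gt0 {ps_uniq} => // p0 ps psE _.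
    have := psE p0; rewrite inE eqxx /= => /esym/andP[sp0 /eqP lp0].
    have [p0P p0n] := tightP _ sp0 lp0.
    have /implyP/(_ p0P) /= p_le := p_min (Bseq p0n).
    case/and3P: pP => sp _ /eqP lp; rewrite lp eqxx -path_weight_tight // lp.
    case/and3P: p0P => ap0 _ _.
    have := path_weight_ge _ _ sp; rewrite lp => p_ge.
    move: sp0; rewrite -path_weight_tight // lp0 => /eqP p0_eq.
    by split=> //; apply/eqP; move: p_le p_ge p0_eq; lra.
  have [pP _] := tightP _ sp lp; split=> //; apply/forallP=> q; apply/implyP.
  case/and3P=> sq _ /eqP lq; have := path_weight_ge _ _ sq; rewrite lq.
  case/and3P: pP => ap _ _; move: sp; rewrite -path_weight_tight // lp => /eqP.
  by lra.
rewrite /num_shortest_paths cardE -(size_map val); apply/perm_size/uniq_perm => //.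
  by rewrite (map_inj_uniq val_inj) enum_uniq.
move=> p; apply/mapP/idP => [[q + ->]|pps]; first by rewrite mem_enum inE shortE.
have := pps; rewrite psE => /andP[sp /eqP lp]; have [_ pn] := tightP _ sp lp.
by exists (Bseq pn) => //; rewrite mem_enum inE shortE.
Qed.

End ShortestPaths.

Lemma sum_ord_seq n (P : pred nat) (f : nat -> nat) (s : seq nat) :
  uniq s -> (forall x, (x \in s) = (x < n)%N && P x) ->
  (\sum_(x < n | P x) f x = \sum_(x <- s) f x)%N.
Proof.
move=> s_uniq sE; rewrite -(big_mkord P f) -big_filter; apply/perm_big/uniq_perm => //.
  by rewrite filter_uniq ?iota_uniq.
by move=> x; rewrite mem_filter mem_index_iota sE andbC.
Qed.

(** * The graphs *)

Section Cluster.
Local Open Scope nat_scope.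
Implicit Types i j m : nat.

(* The slots 0, ..., 2l - 1 of a cell are joined to their successors, and even
   slots also to the next even one; these edges have length 1 and 2. *)
Definition chain m m' := (m' == m.+1) || ~~ odd m && (m' == m.+2).

(* A walk without detour between two slots chooses freely at each even slot
   [y] such that [y] and [y + 2] lie between them. *)
Definition chain_count m m' := 2 ^ ((maxn m m')./2 - uphalf (minn m m')).

(** Recursion on the first step from [m] towards [m0]. The long edge leaves only even slots and must
    not overshoot; where it exists, both summands agree and the count doubles. *)
Lemma chain_count_up m0 m : m0 < m ->
  chain_count m0 m = chain_count m0 m.-1 +
    (if ~~ odd m && (m0.+2 <= m) then chain_count m0 m.-2 else 0).
Proof.
move=> lem; rewrite /chain_count; case: ifP => [h|/negbT h].
  have ->: (maxn m0 m.-1)./2 - uphalf (minn m0 m.-1) = m.-2./2 - uphalf m0 by lia.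
  have ->: (maxn m0 m.-2)./2 - uphalf (minn m0 m.-2) = m.-2./2 - uphalf m0 by lia.
  by rewrite addnn -muln2 -expnSr; congr (_ ^ _); lia.
by rewrite addn0; congr (_ ^ _); lia.
Qed.

Lemma chain_count_down m0 m : m < m0 ->
  chain_count m0 m = chain_count m0 m.+1 +
    (if ~~ odd m && (m.+2 <= m0) then chain_count m0 m.+2 else 0).
Proof.
move=> lem; rewrite /chain_count.
case: ifP => [h|/negbT h].
  have ->: (maxn m0 m.+1)./2 - uphalf (minn m0 m.+1) = m0./2 - (m./2).+1 by lia.
  have ->: (maxn m0 m.+2)./2 - uphalf (minn m0 m.+2) = m0./2 - (m./2).+1 by lia.
  by rewrite addnn -muln2 -expnSr; congr (_ ^ _); lia.
by rewrite addn0; congr (_ ^ _); lia.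
Qed.

Lemma chain_count_id m : chain_count m m = 1.
Proof. by rewrite /chain_count (_ : _ - _ = 0) //; lia. Qed.

Lemma chain_count_gt0 m m' : 0 < chain_count m m'.
Proof. by rewrite expn_gt0. Qed.

Definition bits (c : nat -> bool) n := \sum_(0 <= x < n) c x * 2 ^ x.

Lemma bits_lt c n : bits c n < 2 ^ n.
Proof.
rewrite /bits; elim: n => [|n IHn]; first by rewrite big_geq.
by rewrite big_nat_recr //= expnS mul2n -addnn -addSn leq_add //; case: (c n); lia.
Qed.

Lemma bits_inj c d n x : bits c n = bits d n -> x < n -> c x = d x.
Proof.
elim: n => // n IHn; have := bits_lt c n; have := bits_lt d n.
rewrite /bits !big_nat_recr //= -!/(bits _ n) => dn cn eq_bits.
have cd : c n = d n.
  by move: eq_bits; case: (c n); case: (d n) => //; lia.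
rewrite ltnS leq_eqVlt => /predU1P[-> //|]; apply: IHn.
by move: eq_bits; rewrite cd => /eqP; rewrite eqn_add2r => /eqP.
Qed.

Variables (l : nat) (b : nat -> nat -> nat -> bool).
Hypothesis l_gt0 : 0 < l.

(* The slots joined to the lower right corner of the cell.  The last one always
   is, which makes distances independent of the bits. *)
Definition fan i j m := (m == l.*2.-1) || ~~ odd m && b i j m./2.

Definition fan_count i j m :=
  \sum_(y <- index_iota m l.*2 | fan i j y) chain_count m y.

Lemma chain_count_le m m' : m < l.*2 -> m' < l.*2 ->
  chain_count m m' <= 2 ^ l.-1.
Proof. by move=> mS m'S; rewrite leq_exp2l //; lia. Qed.

Lemma fan_count_gt0 i j m : m < l.*2 -> 0 < fan_count i j m.
Proof.
move=> mS; rewrite /fan_count big_mkcond (bigD1_seq l.*2.-1) ?iota_uniq //=.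
  by rewrite /fan eqxx addn_gt0 chain_count_gt0.
by rewrite mem_index_iota; lia.
Qed.

Lemma fan_count_le i j m : fan_count i j m <= fan_count i j 0.
Proof.
rewrite /fan_count; have [mS|Sm] := leqP m l.*2; last first.
  by rewrite [X in X <= _]big_geq // ltnW.
rewrite [X in _ <= X](@big_cat_nat _ _ _ m) //=; apply: leq_trans (leq_addl _ _).
rewrite big_seq_cond [X in _ <= X]big_seq_cond; apply: leq_sum => y.
by rewrite mem_index_iota => /andP[/andP[my _] _]; rewrite leq_exp2l //; lia.
Qed.

(** Slot [2x] is reached from slot 0 in [2 ^ x] ways, which gives the binary number; the obligatory
    edge from the last slot adds the constant. *)
Lemma fan_count_bits i j : fan_count i j 0 = bits (b i j) l + 2 ^ l.-1.
Proof.
have even_slots p : \sum_(0 <= y < p.*2 | ~~ odd y && b i j y./2) 2 ^ y./2 =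
    bits (b i j) p.
  rewrite /bits; elim: p => [|p IHp]; first by rewrite !big_geq.
  rewrite doubleS 2?big_mkcond 2?big_nat_recr //= -big_mkcond IHp odd_double /=.
  by rewrite [RHS]big_nat_recr //= doubleK addn0; case: (b _ _ _); rewrite ?mul1n ?mul0n.
have [p lE] : exists p, l = p.+1 by exists l.-1; rewrite prednK.
rewrite /fan_count /fan -even_slots lE doubleS [LHS]big_mkcond [in RHS]big_mkcond.
rewrite !(big_nat_recr p.*2.+1) //= odd_double addn0 eqxx /=; congr (_ + _).
  rewrite [LHS]big_seq [RHS]big_seq; apply: eq_bigr => y.
  rewrite mem_index_iota /= => yp; rewrite (_ : (y == _) = false) ?orFb; last lia.
  by case: ifP => // _; rewrite /chain_count; congr (_ ^ _); lia.
by rewrite /chain_count; congr (_ ^ _); lia.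
Qed.

End Cluster.

(** * Coordinates, edges and lengths of the grid *)

Section Gadgets.
Local Open Scope nat_scope.
Variables (k l : nat) (b : nat -> nat -> nat -> bool).
Hypotheses (k_gt0 : 0 < k) (l_gt0 : 0 < l).
Implicit Types (u v i j m : nat).
Notation fan := (fan l b).
Notation fan_count := (fan_count l b).

(* The vertices fill rows of [k] cells of [2l] slots one after the other (the
   last row may be incomplete); the grid points are the slots 0. *)
Definition slot_of v := v %% l.*2.
Definition col_of v := v %/ l.*2 %% k.
Definition row_of v := v %/ l.*2 %/ k.
Definition vtx i j m := (i * k + j) * l.*2 + m.

Lemma slot_lt v : slot_of v < l.*2.
Proof. by rewrite ltn_mod double_gt0. Qed.

Lemma col_lt v : col_of v < k.
Proof. by rewrite ltn_mod. Qed.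

Lemma vtxE v : vtx (row_of v) (col_of v) (slot_of v) = v.
Proof. by rewrite /vtx -divn_eq -divn_eq. Qed.

Lemma vtxK i j m : j < k -> m < l.*2 ->
  [/\ row_of (vtx i j m) = i, col_of (vtx i j m) = j & slot_of (vtx i j m) = m].
Proof.
move=> jk mS; rewrite /row_of /col_of /slot_of.
have -> : vtx i j m %/ l.*2 = i * k + j.
  by rewrite /vtx divnMDl ?double_gt0 // divn_small ?addn0.
by rewrite divnMDl // divn_small // addn0 /vtx !modnMDl !modn_small.
Qed.

Lemma leq_row v : row_of v <= v.
Proof. exact: leq_trans (leq_div _ _) (leq_div _ _). Qed.

(** The numbering is lexicographic, so links lead to larger numbers, and whatever precedes a vertex
    of the graph is in the graph even if the last row is incomplete. *)
Lemma leq_vtx i j m i' j' m' : j < k -> m < l.*2 ->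
  i < i' \/ i = i' /\ (j < j' \/ j = j' /\ m <= m') ->
  vtx i j m <= vtx i' j' m'.
Proof.
move=> jk mS h; rewrite /vtx.
have step x y z : x < y -> z < l.*2 -> x * l.*2 + z < y * l.*2.
  move=> xy zS; apply: (@leq_trans (x.+1 * l.*2)); first by rewrite mulSn; lia.
  by rewrite leq_mul2r xy orbT.
have [ii' | [-> [jj' | [-> mm']]]] := h.
- apply/ltnW/(leq_trans (step _ (i' * k + j') _ _ mS)); last by lia.
  apply: (@leq_trans (i.+1 * k)); first by rewrite mulSn; lia.
  by apply: (@leq_trans (i' * k)); [rewrite leq_mul2r ii' orbT | lia].
- apply/ltnW/(leq_trans (step _ (i' * k + j') _ _ mS)); lia.
- by rewrite leq_add2l.
Qed.

(** Oriented from the smaller vertex; in order: strip, row, column and fan edges. *)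
Definition link u v :=
  [|| [&& row_of v == row_of u, col_of v == col_of u & chain (slot_of u) (slot_of v)],
      [&& row_of v == row_of u, col_of v == (col_of u).+1, slot_of u == 0 &
          slot_of v == 0],
      [&& row_of v == (row_of u).+1, col_of v == col_of u, slot_of u == 0 &
          slot_of v == 0] |
      [&& row_of v == (row_of u).+1, col_of v == (col_of u).+1, slot_of v == 0 &
          fan (row_of u) (col_of u) (slot_of u)]].

(* The increment per row exceeds twice the detour from one slot to another. *)
Definition rung i := 3 * l.*2 * i.+1.

(* The ways through a cell from its upper left to its lower right corner tie, and
   are 1 shorter than the way along the grid lines. *)
Definition len T u v :=
  if row_of v == row_of u then
    if col_of v == col_of u then slot_of v - slot_of u else rung (row_of u)
  else if col_of v == col_of u then T else rung (row_of u) + T - (slot_of u).+1.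

Lemma link_lt u v : link u v -> u < v.
Proof.
rewrite ltn_neqAle => uv; apply/andP; split.
  by apply: contraTneq uv => ->; rewrite /link /chain; lia.
rewrite -(vtxE u) -(vtxE v) leq_vtx ?slot_lt ?col_lt //.
by move: uv; rewrite /link /chain; lia.
Qed.

Lemma len_gt0 T u v : l.*2 <= T -> link u v -> 0 < len T u v.
Proof.
move=> ST uv; rewrite /len /rung; have := slot_lt u.
by move: uv; rewrite /link /chain; do 2?case: eqP => ?; nia.
Qed.

Lemma eq_vtx u i j m : j < k -> m < l.*2 ->
  (u == vtx i j m) = [&& row_of u == i, col_of u == j & slot_of u == m].
Proof.
move=> jk mS; apply/eqP/and3P => [->|[/eqP <- /eqP <- /eqP <-]].
  by have [-> -> ->] := vtxK i _ _ jk mS.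
by rewrite vtxE.
Qed.

(** * Distances and counts for a fixed target *)

Section Potential.
Variables (T i0 j0 m0 : nat).
Hypotheses (j0_lt : j0 < k) (m0_lt : m0 < l.*2).
Hypothesis T_ge : rung i0 * k + 3 * l.*2 <= T.

Definition vert i := T * (i - i0).

(** With truncated subtraction the sum is an absolute difference. *)
Definition horiz j := rung i0 * ((j - j0) + (j0 - j)).

(* The distance to the vertex (i0, j0, m0) from a vertex in row [i0] or below;
   above, 0 is only a lower bound, good enough since it is not tight. *)
Definition pot i j m :=
  if i < i0 then 0
  else if i == i0 then
    if j == j0 then (m - m0) + (m0 - m) else m0 + horiz j + m
  else vert i +
    (if j <= j0 then m0 + horiz j + m
     else if j == j0.+1 then horiz j - m0.+1 + m
     else m0 + horiz j - 1 + m).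

Lemma horiz0 : horiz j0 = 0.
Proof. by rewrite /horiz subnn muln0. Qed.

Lemma horizS j : j0 <= j -> horiz j.+1 = horiz j + rung i0.
Proof. by move=> h; rewrite /horiz -mulnSr; congr (_ * _); lia. Qed.

Lemma horizP j : j < j0 -> horiz j = horiz j.+1 + rung i0.
Proof. by move=> h; rewrite /horiz -mulnSr; congr (_ * _); lia. Qed.

Lemma horiz_le j : j < k -> horiz j + 3 * l.*2 <= T.
Proof.
move=> jk; apply: leq_trans T_ge; rewrite leq_add2r leq_mul2l; apply/orP; right.
by move: jk j0_lt; lia.
Qed.

Lemma rung_ge i : 3 * l.*2 <= rung i.
Proof. by rewrite /rung; nia. Qed.

Lemma rung_gap i : i0 < i -> rung i0 + 3 * l.*2 <= rung i.
Proof. by rewrite /rung; nia. Qed.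

Lemma vertS i : i0 <= i -> vert i.+1 = vert i + T.
Proof. by move=> h; rewrite /vert subSn // mulnSr. Qed.

(** These four conclusions recur for each kind of edge: two Lipschitz bounds, as [D_lip] demands,
    and a tightness test per direction. *)
Lemma pot_chain i j m m' : m' < l.*2 -> chain m m' ->
  [/\ pot i j m' <= pot i j m + (m' - m),
      pot i j m <= pot i j m' + (m' - m),
      (pot i j m' == pot i j m + (m' - m)) =
        (i0 <= i) && ((i == i0) && (j == j0) ==> (m0 <= m)) &
      (pot i j m == pot i j m' + (m' - m)) =
        [&& i == i0, j == j0 & m' <= m0]].
Proof.
rewrite /chain /pot => m'S mm'.
case: (ltngtP i i0) => _ /=; [split; lia | | ].
  by case: (leqP j j0) => _; [|case: eqP => _]; split; lia.
by case: eqP => _; split; lia.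
Qed.

(** [pot] distinguishes only these positions of [j]; each case supplies the facts on [horiz] that
    leave linear arithmetic. *)
Let cases_j (P : nat -> Prop) :
  (forall j, j < j0 -> horiz j = horiz j.+1 + rung i0 ->
     (j.+1 = j0 -> horiz j.+1 = 0) -> P j) ->
  (horiz j0.+1 = rung i0 -> P j0) ->
  (horiz j0.+1 = rung i0 -> horiz j0.+2 = rung i0 + rung i0 -> P j0.+1) ->
  (forall j, j0.+1 < j -> horiz j.+1 = horiz j + rung i0 ->
     rung i0 <= horiz j -> P j) ->
  forall j, P j.
Proof.
have h1 : horiz j0.+1 = rung i0 by rewrite horizS // horiz0.
have h2 : horiz j0.+2 = rung i0 + rung i0 by rewrite horizS // h1.
move=> Plt Peq PS Pgt j; case: (ltngtP j j0) => [jj0|jj0|->]; last exact: Peq.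
  by apply: Plt (horizP _ jj0) _ => // ->; exact: horiz0.
case: (ltngtP j0.+1 j) => [jj|jj|<-]; [|lia|exact: PS].
apply: Pgt => //; first exact: horizS (ltnW jj0).
by rewrite /horiz leq_pmulr //; lia.
Qed.

Let cases_i (P : nat -> Prop) :
  (forall i, i.+1 < i0 -> P i) -> (forall i, i.+1 = i0 -> P i) ->
  (vert i0 = 0 -> vert i0.+1 = T -> P i0) ->
  (forall i, i0 < i -> rung i0 + 3 * l.*2 <= rung i ->
     vert i.+1 = vert i + T -> P i) ->
  forall i, P i.
Proof.
move=> Plt PS Peq Pgt i; case: (ltngtP i i0) => [h|h|->].
- by case: (ltngtP i.+1 i0) => h'; [exact: Plt | lia | exact: PS].
- by apply: Pgt => //; [exact: rung_gap | exact: vertS (ltnW h)].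
- by apply: Peq; rewrite /vert ?subnn ?subSnn ?muln0 ?muln1.
Qed.

Ltac pot_cases :=
  clear T_ge j0_lt k_gt0; repeat (case: ifP => ?; try by exfalso; lia); split; lia.

Lemma pot_row i j : j.+1 < k ->
  [/\ pot i j.+1 0 <= pot i j 0 + rung i,
      pot i j 0 <= pot i j.+1 0 + rung i,
      (pot i j.+1 0 == pot i j 0 + rung i) = (i == i0) && (j0 <= j) &
      (pot i j 0 == pot i j.+1 0 + rung i) = (i == i0) && (j < j0)].
Proof.
move=> jk; have := (horiz0, rung_ge i0, rung_ge i); case=> [[h0 rge] rge'].
rewrite /pot; elim/cases_j: j jk; elim/cases_i: i rge' => *; pot_cases.
Qed.

Lemma pot_col i j : j < k ->
  [/\ pot i.+1 j 0 <= pot i j 0 + T,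
      pot i j 0 <= pot i.+1 j 0 + T,
      (pot i.+1 j 0 == pot i j 0 + T) = (i0 < i) || (i == i0) && (j <= j0) &
      (pot i j 0 == pot i.+1 j 0 + T) = false].
Proof.
move=> jk; have rge := rung_ge i0; have hle := horiz_le _ jk; have h0 := horiz0.
rewrite /pot; elim/cases_j: j jk hle; elim/cases_i: i => *; pot_cases.
Qed.

(** The term [m.+1] in the length offsets the steps along the strip, so all usable slots tie; in
    lower rows the larger [rung i] rules the edge out. *)
Lemma pot_fan i j m : j.+1 < k -> m < l.*2 ->
  [/\ pot i.+1 j.+1 0 <= pot i j m + (rung i + T - m.+1),
      pot i j m <= pot i.+1 j.+1 0 + (rung i + T - m.+1),
      (pot i.+1 j.+1 0 == pot i j m + (rung i + T - m.+1)) =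
        [&& i == i0, j0 <= j & (j == j0) ==> (m0 <= m)] &
      (pot i j m == pot i.+1 j.+1 0 + (rung i + T - m.+1)) = false].
Proof.
move=> jk mS; have rge := rung_ge i0; have rge' := rung_ge i; have h0 := horiz0.
have hle := horiz_le _ jk; have hle' := horiz_le _ (ltnW jk).
rewrite /pot; elim/cases_j: j jk hle hle'; elim/cases_i: i rge' => *; pot_cases.
Qed.

(* The edges from (i, j, m) to (i', j', m') along which [pot] decreases by the
   full length: along the chain towards slot 0 or, in the target's cell, towards
   slot [m0]; along row [i0]; up a column; and from a corner into a strip. *)
Definition tight i j m i' j' m' :=
  [|| [&& i' == i, j' == j, chain m' m, i0 <= i &
          (i == i0) && (j == j0) ==> (m0 <= m')],
      [&& i == i0, j == j0, i' == i, j' == j, chain m m' & m' <= m0],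
      [&& i == i0, i' == i, j == j'.+1, m == 0, m' == 0 & j0 <= j'],
      [&& i == i0, i' == i, j' == j.+1, m == 0, m' == 0 & j < j0],
      [&& i == i'.+1, j' == j, m == 0, m' == 0 &
          (i0 < i') || (i' == i0) && (j <= j0)] |
      [&& i == i'.+1, j == j'.+1, m == 0, fan i' j' m', i' == i0, j0 <= j' &
          (j' == j0) ==> (m0 <= m')]].

Definition pot_at v := pot (row_of v) (col_of v) (slot_of v).

Lemma pot_at_link u v : link u v ->
  [/\ pot_at v <= pot_at u + len T u v, pot_at u <= pot_at v + len T u v,
      (pot_at v == pot_at u + len T u v) =
        tight (row_of v) (col_of v) (slot_of v) (row_of u) (col_of u) (slot_of u) &
      (pot_at u == pot_at v + len T u v) =
        tight (row_of u) (col_of u) (slot_of u) (row_of v) (col_of v) (slot_of v)].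
Proof.
have := (slot_lt u, slot_lt v); have := col_lt v.
rewrite /pot_at /link /len.
move: (row_of u) (row_of v) (col_of u) (col_of v) (slot_of u) (slot_of v).
move=> i i' j j' m m'.
move=> j'k [mS m'S] /or4P[] /and3P[/eqP i'E /eqP j'E]; subst i' j'; rewrite ?eqxx.
- move=> mm'; have [-> -> -> ->] := pot_chain i j _ _ m'S mm'.
  by split=> //; move: mm'; rewrite /tight /chain; lia.
- case/andP=> /eqP m_0 /eqP m'_0; subst m m'; rewrite eqn_leq ltnn /=.
  by have [-> -> -> ->] := pot_row i j j'k; split=> //; rewrite /tight /chain; lia.
- case/andP=> /eqP m_0 /eqP m'_0; subst m m'; rewrite eqn_leq ltnn /=.
  by have [-> -> -> ->] := pot_col i j j'k; split=> //; rewrite /tight /chain; lia.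
case/andP=> /eqP m'_0 fan_m; subst m'; rewrite !(eqn_leq _.+1) !ltnn /=.
have [-> -> -> ->] := pot_fan i j m j'k mS; split=> //; rewrite /tight ?fan_m /chain; lia.
Qed.

(* The number of shortest paths to the target from a grid point of column [j]
   below row [i0]. *)
Definition gate j :=
  if j <= j0 then chain_count m0 0
  else if j == j0.+1 then fan_count i0 j0 m0
  else chain_count m0 0 * fan_count i0 j.-1 0.

(** Outside the target's cell a walk first descends its own strip to slot 0, whence the factor
    [chain_count 0 m]. *)
Definition num_tight i j m :=
  if i < i0 then 0
  else if (i == i0) && (j == j0) then chain_count m0 m
  else (if i == i0 then chain_count m0 0 else gate j) * chain_count 0 m.

Definition num_tight_at v := num_tight (row_of v) (col_of v) (slot_of v).

Lemma num_tight_at_vtx i j m : j < k -> m < l.*2 ->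
  num_tight_at (vtx i j m) = num_tight i j m.
Proof.
by move=> jk mS; rewrite /num_tight_at; have [-> -> ->] := vtxK i _ _ jk mS.
Qed.

Lemma num_tight_at_target : num_tight_at (vtx i0 j0 m0) = 1.
Proof. by rewrite num_tight_at_vtx // /num_tight ltnn !eqxx /= chain_count_id. Qed.

Ltac side lt_n := clear T_ge; by move=> *; first [lia | apply: lt_n; lia].

Ltac tight_cases P :=
  let u := fresh "u" in clear T_ge; intro u; rewrite /P /tight /chain;
  generalize (row_of u) (col_of u) (slot_of u) => {}u ? ?; apply/idP/idP;
  [repeat (case/orP); lia | case/and3P=> /eqP -> /eqP ->;
     repeat (case/orP); repeat (case/andP => ?); move/eqP ->; rewrite ?eqxx ?ltnn; lia].

(** Every tight successor precedes [v] or the target in the numbering, so restricting to [u < n]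
    loses none. There are at most two of them, except where the walk enters a fan. *)
Lemma num_tight_at_rec n v : v < n -> vtx i0 j0 m0 < n -> v != vtx i0 j0 m0 ->
  num_tight_at v = \sum_(u < n | tight (row_of v) (col_of v) (slot_of v)
                                 (row_of u) (col_of u) (slot_of u)) num_tight_at u.
Proof.
move=> vn tn v_t; pose P u :=
    tight (row_of v) (col_of v) (slot_of v) (row_of u) (col_of u) (slot_of u).
move: v_t; rewrite -[v in v != _]vtxE (eq_vtx _ i0 j0 m0) //.
have [-> -> ->] := vtxK (row_of v) _ _ (col_lt v) (slot_lt v).
have lt_n i j m : j < k -> m < l.*2 ->
   (i < row_of v \/ i = row_of v /\ (j < col_of v \/ j = col_of v /\ m <= slot_of v)) \/
   (i < i0 \/ i = i0 /\ (j < j0 \/ j = j0 /\ m <= m0)) -> vtx i j m < n.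
  move=> jk mS [h|h]; first by apply: leq_ltn_trans vn; rewrite -(vtxE v) leq_vtx.
  by apply: leq_ltn_trans tn; rewrite leq_vtx.
have sumE s : uniq s -> {in s, forall u, u < n} -> (forall u, (u \in s) = P u) ->
    \sum_(u < n | P u) num_tight_at u = \sum_(u <- s) num_tight_at u.
  move=> s_uniq s_lt sE; apply: sum_ord_seq => // u; rewrite -sE andbC.
  by case us: (u \in s); rewrite //= s_lt.
have sum0 : (forall u, P u = false) -> \sum_(u < n | P u) num_tight_at u = 0.
  by move=> P0; rewrite big_pred0.
have sum1 i j m : j < k -> m < l.*2 -> vtx i j m < n ->
    (forall u, P u = [&& row_of u == i, col_of u == j & slot_of u == m]) ->
    \sum_(u < n | P u) num_tight_at u = num_tight i j m.
  move=> jk mS ltn PE; rewrite (sumE [:: vtx i j m]) // ?big_seq1 ?num_tight_at_vtx //.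
    by move=> u; rewrite inE => /eqP ->.
  by move=> u; rewrite inE PE -eq_vtx.
have sum2 i j m m' (c : bool) : j < k -> m < l.*2 -> (c -> m' < l.*2) ->
    vtx i j m < n -> (c -> vtx i j m' < n) -> (c -> m != m') ->
    (forall u, P u = [&& row_of u == i, col_of u == j &
                         (slot_of u == m) || c && (slot_of u == m')]) ->
    \sum_(u < n | P u) num_tight_at u =
      num_tight i j m + (if c then num_tight i j m' else 0).
  case: c => [jk mS m'S ltn ltn' mm' PE|jk mS _ ltn _ _ PE]; last first.
    by rewrite addn0 (sum1 i j m) // => u; rewrite PE orbF.
  rewrite (sumE [:: vtx i j m; vtx i j m']).
  - by rewrite big_cons big_seq1 !num_tight_at_vtx ?m'S.
  - rewrite /= inE andbT eq_vtx ?m'S //; have [-> -> ->] := vtxK i _ _ jk mS.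
    by rewrite !eqxx mm'.
  - by move=> u; rewrite !inE => /orP[]/eqP ->; rewrite ?ltn'.
  by move=> u; rewrite !inE PE !eq_vtx ?m'S // -!andb_orr.
rewrite [LHS]/num_tight_at.
move: (row_of v) (col_of v) (slot_of v) (col_lt v) (slot_lt v) @P lt_n sumE sum0 sum1 sum2.
move=> i j m jk mS P lt_n sumE sum0 sum1 sum2 v_t; clear vn tn.
rewrite [LHS]/num_tight; case: ltnP => [lti|lei].
  rewrite sum0 // => u; apply/negP; rewrite /P /tight.
  by repeat (case/orP); lia.
have [/andP[/eqP iE /eqP jE]|not_own] := boolP ((i == i0) && (j == j0)).
  subst i j; have {v_t} : m != m0 by move: v_t; rewrite !eqxx.
  case: ltngtP => // mm0 _.
    rewrite chain_count_down // (sum2 i0 j0 m.+1 m.+2 (~~ odd m && (m.+2 <= m0)));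
      [by rewrite /num_tight ltnn !eqxx | side lt_n .. | tight_cases P].
  rewrite chain_count_up // (sum2 i0 j0 m.-1 m.-2 (~~ odd m && (m0.+2 <= m)));
    [by rewrite /num_tight ltnn !eqxx | side lt_n .. | tight_cases P].
clear v_t; case: (posnP m) => [m_0|m_gt0]; last first.
  rewrite (chain_count_up 0 m) // (sum2 i j m.-1 m.-2 (~~ odd m && (2 <= m)));
    [ | side lt_n .. | tight_cases P].
  rewrite /num_tight (ltnNge i) lei (negPf not_own) mulnDr.
  by congr addn; case: (~~ _ && _); rewrite ?muln0.
subst m; rewrite chain_count_id muln1; case: eqP => [iE|/eqP i_i0].
  subst i; rewrite eqxx /= in not_own; case: ltngtP not_own => // jj0 _.
    rewrite (sum1 i0 j.+1 0); [ | side lt_n .. | tight_cases P].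
    rewrite /num_tight ltnn eqxx chain_count_id muln1 /=.
    by case: eqP => // ->.
  rewrite (sum1 i0 j.-1 0); [ | side lt_n .. | tight_cases P].
  rewrite /num_tight ltnn eqxx chain_count_id muln1 /=.
  by case: eqP => // ->.
have {lei i_i0 not_own} lti : i0 < i by lia.
(* At grid points below row [i0] the only tight step is up the column, unless the point lies in row
   [i0.+1] to the right of [j0], where the tight steps are fan edges. *)
have [up|fans] := boolP ((j <= j0) || (i0.+1 < i)).
  rewrite (sum1 i.-1 j 0); [ | side lt_n .. | tight_cases P].
  rewrite /num_tight ltnNge (_ : i0 <= i.-1) ?chain_count_id ?muln1 /=; last lia.
  rewrite /gate; case: (leqP j j0) up => [jj0|jj0 up].
    by do 2?case: ifP.
  by rewrite (_ : i.-1 == i0 = false) //; lia.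
have {fans}[iE jj0] : i = i0.+1 /\ j0 < j by lia.
subst i; rewrite /gate leqNgt jj0 /=.
(* In the target's own cell, slots before [m0] would overshoot the target. *)
pose first_slot := if j == j0.+1 then m0 else 0.
pose s := [seq vtx i0 j.-1 y | y <- index_iota first_slot l.*2 & fan i0 j.-1 y].
have j1k : j.-1 < k by lia.
have memP u : reflect (exists2 y, [&& first_slot <= y, y < l.*2 & fan i0 j.-1 y]
                        & u = vtx i0 j.-1 y) (u \in s).
  apply: (iffP mapP) => -[y yP ->]; exists y => //; move: yP;
    by rewrite mem_filter mem_index_iota => /and3P[-> -> ->].
rewrite -[RHS]/(\sum_(u < n | P u) num_tight_at u) (sumE s).
- rewrite big_map big_filter.
  have -> : \sum_(y <- index_iota first_slot l.*2 | fan i0 j.-1 y)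
        num_tight_at (vtx i0 j.-1 y) =
      \sum_(y <- index_iota first_slot l.*2 | fan i0 j.-1 y) num_tight i0 j.-1 y.
    rewrite big_seq_cond [RHS]big_seq_cond; apply: eq_bigr => y.
    by rewrite mem_index_iota => /andP[/andP[_ yS] _]; rewrite num_tight_at_vtx.
  rewrite /first_slot /num_tight ltnn eqxx /=; case: eqP => [->|/eqP j_j0].
    by rewrite /= eqxx.
  by rewrite (_ : j.-1 == j0 = false) ?big_distrr //; lia.
- rewrite map_inj_in_uniq ?filter_uniq ?iota_uniq // => y z.
  rewrite !mem_filter !mem_index_iota => /and3P[_ _ yS] /and3P[_ _ zS] yz.
  have [_ _ <-] := vtxK i0 _ _ j1k yS; have [_ _ <-] := vtxK i0 _ _ j1k zS.
  by rewrite yz.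
- by move=> u /memP[y /and3P[_ yS _] ->]; side lt_n.
move=> u; apply/memP/idP => [[y /and3P[y_ge yS y_fan] ->]|].
  rewrite /P; have [-> -> ->] := vtxK i0 _ _ j1k yS.
  move: y_ge; rewrite /tight y_fan /first_slot.
  by case: (j =P j0.+1) => ?; lia.
have := vtxE u; have := slot_lt u; rewrite /P /tight /chain.
move: (row_of u) (col_of u) (slot_of u) => r c y yS uE; repeat case/orP; try lia.
case/and3P=> /eqP[rE] /eqP cE /and5P[_ y_fan _ _ y_ge].
exists y; last by rewrite -uE cE -rE.
rewrite yS cE /= rE y_fan andbT /first_slot; move: y_ge.
by rewrite cE eqSS /=; case: (_ =P _) => ?; lia.
Qed.

Lemma num_tight_gt0 i j m : i0 <= i -> 0 < num_tight i j m.
Proof.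
move=> lei; rewrite /num_tight (ltnNge i) lei /=.
case: ifP => _; rewrite ?chain_count_gt0 //.
rewrite muln_gt0 chain_count_gt0 andbT /gate.
by do ?case: ifP => _; rewrite ?muln_gt0 ?chain_count_gt0 ?fan_count_gt0 // double_gt0.
Qed.

Lemma gate_le j : gate j <= 2 ^ l.-1 * (2 ^ l + 2 ^ l.-1 - 1).
Proof.
clear T_ge.
have fan_le i j' m : fan_count i j' m <= 2 ^ l + 2 ^ l.-1 - 1.
  apply: leq_trans; first exact: fan_count_le.
  rewrite fan_count_bits //.
  by have := bits_lt (b i j') l; lia.
have X_gt0 : 0 < 2 ^ l + 2 ^ l.-1 - 1.
  by have := expn_gt0 2 l; have := expn_gt0 2 l.-1; lia.
rewrite /gate; case: ifP => _.
  by apply: leq_trans (leq_pmulr _ X_gt0); rewrite chain_count_le ?double_gt0.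
case: ifP => _; last by rewrite leq_mul ?chain_count_le ?double_gt0.
by apply: leq_trans (leq_pmull _ _); rewrite ?expn_gt0.
Qed.

(** Two partial strips give at most [2 ^ l.-1] each and the full one less than [2 ^ l.+1]; the
    exponents add up to [3 * l - 1]. *)
Lemma num_tight_lt i j m : m < l.*2 -> num_tight i j m < 2 ^ (3 * l - 1).
Proof.
clear T_ge; move=> mS; set X := 2 ^ l + 2 ^ l.-1 - 1.
have Y_gt0 : 0 < 2 ^ l.-1 by rewrite expn_gt0.
have lE : 2 ^ l = 2 * 2 ^ l.-1 by rewrite -expnS prednK.
apply: (@leq_ltn_trans (2 ^ l.-1 * X * 2 ^ l.-1)); last first.
  have -> : 2 ^ (3 * l - 1) = 2 ^ l.-1 * (2 * 2 ^ l) * 2 ^ l.-1.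
    by rewrite -expnS -!expnD; congr (_ ^ _); lia.
  by rewrite ltn_pmul2r // ltn_pmul2l // /X; lia.
have h0 : 0 < l.*2 by rewrite double_gt0.
have X_gt0 : 0 < X by rewrite /X; lia.
have le1 m1 m2 : m1 < l.*2 -> m2 < l.*2 -> chain_count m1 m2 <= 2 ^ l.-1 * X.
  by move=> ? ?; apply: leq_trans (leq_pmulr _ X_gt0); rewrite chain_count_le.
rewrite /num_tight; case: ifP => _; first by [].
case: ifP => _; first by apply: leq_trans (leq_pmulr _ Y_gt0); exact: le1.
by rewrite leq_mul ?chain_count_le //; case: ifP => _; [exact: le1 | exact: gate_le].
Qed.

End Potential.

End Gadgets.

(** * Straight-line drawing *)

Section Drawing.
Variables (R : realType) (k l : nat) (b : nat -> nat -> nat -> bool).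
Hypotheses (k_gt0 : (0 < k)%N) (l_gt0 : (0 < l)%N).
Implicit Types (u v i j m : nat) (x y a : R).
Notation slot := (slot_of l).
Notation col := (col_of k l).
Notation row := (row_of k l).
Notation S := (l.*2%:R : R).

(* In cell coordinates even slots lie on the line y = 2 x and odd slots on
   y = x, so the triangles are on one side of the even line and the fan to the
   corner (2 l, 8 l) is on the other one, except for the edge from the last slot,
   which lies to the right of all triangles. *)
Definition height m : nat := if odd m then m else 2 * m.

Definition place v : R * R :=
  (S * (col v)%:R + (slot v)%:R, 4 * S * (row v)%:R + (height (slot v))%:R).

Definition segment (p q : R * R) a : R * R :=
  ((1 - a) * p.1 + a * q.1, (1 - a) * p.2 + a * q.2).

Lemma segment_continuous p q : continuous (segment p q).
Proof.
have lin (c d : R) : continuous (fun a : R => (1 - a) * c + a * d).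
  move=> a; apply: cvgD; apply: cvgM; try exact: cvg_cst; last exact: cvg_id.
  by apply: cvgB; [exact: cvg_cst | exact: cvg_id].
by move=> a; exact: (cvg_pair (lin p.1 q.1 a) (lin p.2 q.2 a)).
Qed.

Lemma segment_inj p q : p != q -> injective (segment p q).
Proof.
case: p q => [p1 p2] [q1 q2]; rewrite xpair_eqE negb_and => pq a a' [/= h1 h2].
have [p1q1|p2q2] := orP pq.
  apply: (mulIf (x := q1 - p1)); first by rewrite subr_eq0 eq_sym.
  by move: h1; lra.
apply: (mulIf (x := q2 - p2)); first by rewrite subr_eq0 eq_sym.
by move: h2; lra.
Qed.

Lemma S_ge2 : 2 <= S.
Proof. by rewrite ler_nat; lia. Qed.

Lemma slot_le v : (slot v)%:R + 1 <= S.
Proof. by rewrite natr1 ler_nat slot_lt. Qed.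

Lemma cell_unique (s : R) n n' x x' : 0 <= x < s -> 0 <= x' < s ->
  s * n%:R + x = s * n'%:R + x' -> n = n' /\ x = x'.
Proof.
move=> /andP[x0 xs] /andP[x'0 x's] E.
suff nn' : n = n' by split=> //; move: E; rewrite nn'; lra.
have s0 : 0 < s by lra.
apply/eqP; case: ltngtP => // h; exfalso.
  have : s * (n%:R + 1) <= s * n'%:R by rewrite ler_pM2l // natr1 ler_nat.
  by lra.
have : s * (n'%:R + 1) <= s * n%:R by rewrite ler_pM2l // natr1 ler_nat.
by lra.
Qed.

Variant edge_kind := Row | Col | Step | Chord | Fan | LastFan.

(* Which points an open edge of each kind covers, in coordinates relative to
   the cell of its upper left end, [m] being the slot of that end. *)
Definition locus (e : edge_kind) m x y : Prop :=
  match e with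
  | Row => [/\ m = 0%N, y = 0, 0 < x & x < S]
  | Col => [/\ m = 0%N, x = 0, 0 < y & y < 4 * S]
  | Step => [/\ m%:R < x < m%:R + 1, m%:R + 2 <= S, 0 < y & y < 2 * x]
  | Chord => [/\ ~~ odd m, m%:R < x < m%:R + 2, m%:R + 4 <= S & y = 2 * x]
  | Fan => [/\ ~~ odd m, m%:R + 2 <= S, m%:R < x < S, 2 * x < y < 4 * S &
            (S - x) * (4 * S - 2 * m%:R) = (4 * S - y) * (S - m%:R)]
  | LastFan => [/\ m = l.*2.-1, S - 1 < x < S, 0 < y < 4 * S &
                (S - x) * (3 * S + 1) = 4 * S - y]
  end.

Definition target (e : edge_kind) i j m : nat * nat * nat :=
  match e with
  | Row => (i, j.+1, 0) | Col => (i.+1, j, 0) | Step => (i, j, m.+1)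
  | Chord => (i, j, m.+2) | Fan | LastFan => (i.+1, j.+1, 0)
  end%N.

Lemma link_locus u v a : link k l b u v -> 0 < a < 1 ->
  exists e x y, [/\ locus e (slot u) x y,
    (row v, col v, slot v) = target e (row u) (col u) (slot u),
    (segment (place u) (place v) a).1 = S * (col u)%:R + x &
    (segment (place u) (place v) a).2 = 4 * S * (row u)%:R + y].
Proof.
move=> uv /andP[a0 a1]; have S2 := S_ge2; have uS := slot_le u; have vS := slot_le v.
have uv_loc e X Y : (segment (place u) (place v) a).1 = S * (col u)%:R + X ->
    (segment (place u) (place v) a).2 = 4 * S * (row u)%:R + Y ->
    (row v, col v, slot v) = target e (row u) (col u) (slot u) ->
    locus e (slot u) X Y -> exists e x y, [/\ locus e (slot u) x y,
    (row v, col v, slot v) = target e (row u) (col u) (slot u),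
    (segment (place u) (place v) a).1 = S * (col u)%:R + x &
    (segment (place u) (place v) a).2 = 4 * S * (row u)%:R + y].
  by move=> *; exists e, X, Y.
move: uv_loc uv; rewrite /place /segment /link /=; have := slot_lt _ l_gt0 u.
move: (row u) (row v) (col u) (col v) (slot u) (slot v) uS vS.
move=> i i' j j' m m' mS m'S mlt loc.
case/or4P=> /and3P[/eqP iE /eqP jE]; subst i' j'.
- case/orP=> [/eqP mE|/andP[m_even /eqP mE]]; subst m'.
    apply: (loc Step (m%:R + a) ((1 - a) * (height m)%:R + a * (height m.+1)%:R)) => //=.
    + by rewrite -natr1; lra.
    + by lra.
    rewrite /height /=; rewrite -natr1 in m'S.
    case: (boolP (odd m)) => m_odd /=; rewrite ?natrM -?natr1.
      have m1 : 1 <= m%:R :> R by rewrite ler1n; case: m m_odd {loc mlt mS m'S}.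
      by split; [apply/andP; split; lra | lra | nra | nra].
    have m1 : 0 <= m%:R :> R by rewrite ler0n.
    by split; [apply/andP; split; lra | lra | nra | nra].
  apply: (loc Chord (m%:R + 2 * a)
                    ((1 - a) * (height m)%:R + a * (height m.+2)%:R)) => //=.
  + by rewrite -addn2 natrD; lra.
  + by lra.
  rewrite /height /= negbK (negPf m_even) !natrM -[m.+2]addn2 natrD.
  split=> //; [apply/andP; split; lra | | lra].
  (* [m.+2] is an even slot, hence at most [l.*2 - 2]. *)
  have : (m + 4 <= l.*2)%N.
    by move: m'S; rewrite natr1 ler_nat; move: m_even; lia.
  by rewrite -(ler_nat R) natrD.
- case/andP=> /eqP m_0 /eqP m'_0; subst m m'.
  apply: (loc Row (S * a) 0) => //=; rewrite /height /= ?muln0.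
  + by rewrite -natr1; lra.
  + by lra.
  by split=> //; nra.
- case/andP=> /eqP m_0 /eqP m'_0; subst m m'.
  apply: (loc Col 0 (4 * S * a)) => //=; rewrite /height /= ?muln0.
  + by lra.
  + by rewrite -natr1; lra.
  by split=> //; nra.
case/andP=> /eqP m'_0; subst m'; rewrite /fan.
have m0 : 0 <= m%:R :> R by rewrite ler0n.
have X1 : (1 - a) * (S * j%:R + m%:R) + a * (S * j.+1%:R + 0%:R) =
   S * j%:R + ((1 - a) * m%:R + a * S) by rewrite -natr1; lra.
have Y1 : (1 - a) * (4 * S * i%:R + (height m)%:R) +
          a * (4 * S * i.+1%:R + (height 0)%:R) =
   4 * S * i%:R + ((1 - a) * (height m)%:R + 4 * a * S).
  by rewrite (_ : height 0 = 0%N) // -natr1; lra.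
case/orP=> [/eqP mE|/andP[m_even _]].
  apply: (loc LastFan _ _ X1 Y1) => //=.
  have -> : height m = m by rewrite /height ifT // mE; lia.
  have : m%:R + 1 = S by rewrite natr1 mE prednK // double_gt0.
  by move=> h; split=> //; try (apply/andP; split); nra.
apply: (loc Fan _ _ X1 Y1) => //=.
have m2 : m%:R + 2 <= S by rewrite -natrD ler_nat; move: m_even mlt; lia.
rewrite /height (negPf m_even) natrM; split=> //; try (apply/andP; split); nra.
Qed.

Lemma locus_cell e m x y : locus e m x y ->
  [/\ 0 <= x < S, 0 <= y < 4 * S & 0 < x \/ 0 < y].
Proof.
have S2 := S_ge2; have m0 : 0 <= m%:R :> R by rewrite ler0n.
case: e => /= [[_ -> ? ?]|[_ -> ? ?]|[/andP[? ?] ? ? ?]|[_ /andP[? ?] ? ->]|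
               [_ ? /andP[? ?] /andP[? ?] _]|[_ /andP[? ?] /andP[? ?] _]];
  split; try (apply/andP; split); lra.
Qed.

Lemma natr_lt_add m n p : (m%:R < n%:R + p%:R :> R) -> (m < n + p)%N.
Proof. by rewrite -natrD ltr_nat. Qed.

(** Open [Step] and [LastFan] edges have no integral abscissa, a [Chord] passes above one odd slot,
    and [Fan] edges run above the line y = 2 x, where no slot lies. *)
Lemma locus_not_place e m n x : locus e m x (height n)%:R -> x = n%:R ->
  (0 < n)%N -> False.
Proof.
move=> + xE; subst x; have S2 := S_ge2.
case: e => /= [[_ h0 n0 _]|[_ x0 _ _]|[/andP[h1 h2] _ _ _]|[m_even /andP[h1 h2] _ h3]|
               [m_even h _ /andP[h1 _] _]|[mE /andP[h1 h2] _ _]] n_gt0.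
- move/eqP: h0; rewrite pnatr_eq0 /height; case: ifP => _; lia.
- by move/eqP: x0; rewrite pnatr_eq0; lia.
- by have := natr_lt_add _ _ 1 h2; rewrite ltr_nat in h1; lia.
- have := natr_lt_add _ _ 2 h2; rewrite ltr_nat in h1 => h4.
  move: h3; rewrite -natrM => /eqP; rewrite eqr_nat /height; case: ifP; lia.
- move: h1; rewrite -natrM ltr_nat /height; case: ifP; lia.
- have : (n < l.*2)%N by rewrite -(ltr_nat R).
  suff : (l.*2 < n + 1)%N by lia.
  by apply: natr_lt_add; lra.
Qed.

(** A [Fan] and a [LastFan] edge share their corner, so another common point, at horizontal distance
    [p] from it, would force equal slopes; but the last edge is steeper. *)
Lemma fan_slope (p t : R) : 0 < p -> t + 2 <= S ->
  p * (4 * S - 2 * t) = p * (3 * S + 1) * (S - t) -> False.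
Proof.
move=> p0 tS; have S2 := S_ge2.
rewrite -mulrA => /(mulfI (lt0r_neq0 p0)).
have -> : (3 * S + 1) * (S - t) = (3 * S - 1) * (S - t) + 2 * (S - t) by ring.
have : (3 * S - 1) * 2 <= (3 * S - 1) * (S - t) by rewrite ler_pM2l; lra.
by lra.
Qed.

(** The axes, the line y = 2 x and the abscissa S - 1 separate the kinds, except [Fan] from
    [LastFan], where [fan_slope] applies. *)
Lemma locus_unique e e' m m' x y : (m < l.*2)%N -> (m' < l.*2)%N ->
  locus e m x y -> locus e' m' x y -> e = e' /\ m = m'.
Proof.
move=> mS m'S; have S2 := S_ge2; have m0 : 0 <= m%:R :> R by rewrite ler0n.
have m'0 : 0 <= m'%:R :> R by rewrite ler0n.
case: e => /= [[-> -> ? ?]|[-> -> ? ?]|[/andP[x1 x2] ? ? ?]|[m_even /andP[x1 x2] ? yE]|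
               [m_even ? /andP[? ?] /andP[? ?] xy]|[mE /andP[? ?] /andP[? ?] xy]];
case: e' => /= [[-> ? ? ?]|[-> ? ? ?]|[/andP[x1' x2'] ? ? ?]|[m'_even /andP[x1' x2'] ? ?]|
               [m'_even ? /andP[? ?] /andP[? ?] xy']|[m'E /andP[? ?] /andP[? ?] xy']];
  try by []; try (exfalso; lra).
- split=> //; have := natr_lt_add m m' 1 (lt_trans x1 x2').
  by have := natr_lt_add m' m 1 (lt_trans x1' x2); clear; lia.
- split=> //; have := natr_lt_add m m' 2 (lt_trans x1 x2').
  by have := natr_lt_add m' m 2 (lt_trans x1' x2); move: m_even m'_even; clear; lia.
(* Eliminate 4 S - y from the equations of the two fan lines. *)
- split=> //; have : (S - x) * (2 * S * (m%:R - m'%:R)) = 0.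
    transitivity ((S - x) * (4 * S - 2 * m%:R) * (S - m'%:R) -
                  (S - x) * (4 * S - 2 * m'%:R) * (S - m%:R)); first by ring.
    by rewrite xy xy'; ring.
  have /mulfI nz : (S - x) * (2 * S) != 0 by apply: mulf_neq0; lra.
  by move=> h; apply/eqP; rewrite -(eqr_nat R); apply/eqP/nz; lra.
- by exfalso; apply: (@fan_slope (S - x) m%:R); rewrite ?xy ?xy' //; lra.
- by exfalso; apply: (@fan_slope (S - x) m'%:R); rewrite ?xy ?xy' //; lra.
- by rewrite mE m'E.
Qed.

Let place_cell v :
  0 <= ((slot v)%:R : R) < S /\ 0 <= ((height (slot v))%:R : R) < 4 * S.
Proof.
have vS := slot_lt _ l_gt0 v; rewrite !ler0n -[4]/(4%:R : R) -natrM !ltr_nat.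
by split=> //=; rewrite /height; case: ifP; lia.
Qed.

Lemma place_inj : injective place.
Proof.
move=> u v [xE yE]; have [ux uy] := place_cell u; have [vx vy] := place_cell v.
have [colE /eqP] := cell_unique _ _ _ _ _ ux vx xE; rewrite eqr_nat => /eqP slotE.
have [rowE _] := cell_unique _ _ _ _ _ uy vy yE.
by rewrite -(vtxE k l u) -(vtxE k l v) rowE colE slotE.
Qed.

Lemma height_gt0 m : (0 < height m)%N = (0 < m)%N.
Proof. by rewrite /height; case: ifP => _; clear; lia. Qed.

Lemma segment_place_notin u v w a : link k l b u v -> 0 < a < 1 ->
  segment (place u) (place v) a <> place w.
Proof.
move=> uv a01 uvw; have [e [x [y [loc _]]]] := link_locus _ _ _ uv a01.
rewrite uvw /= => xE yE; have [wx wy] := place_cell w.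
have [ux uy pos] := locus_cell _ _ _ _ loc.
have [_ wxE] := cell_unique _ _ _ _ _ wx ux xE.
have [_ wyE] := cell_unique _ _ _ _ _ wy uy yE.
move: loc; rewrite -wyE => /locus_not_place; apply=> //.
by move: pos; rewrite -wxE -wyE !ltr0n height_gt0; case.
Qed.

Lemma segments_disjoint u v u' v' a a' : link k l b u v -> link k l b u' v' ->
  0 < a < 1 -> 0 < a' < 1 ->
  segment (place u) (place v) a = segment (place u') (place v') a' ->
  u = u' /\ v = v'.
Proof.
move=> uv u'v' a01 a'01 E.
have [e [x [y [loc tgt]]]] := link_locus _ _ _ uv a01.
have [e' [x' [y' [loc' tgt' xE' yE']]]] := link_locus _ _ _ u'v' a'01.
rewrite E xE' yE' => xE yE.
have [x0S y0S _] := locus_cell _ _ _ _ loc; have [x0S' y0S' _] := locus_cell _ _ _ _ loc'.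
have [colE xx'] := cell_unique _ _ _ _ _ x0S' x0S xE.
have [rowE yy'] := cell_unique _ _ _ _ _ y0S' y0S yE.
rewrite xx' yy' in loc'.
have uS := slot_lt _ l_gt0 u; have u'S := slot_lt _ l_gt0 u'.
have [ee' slotE] := locus_unique _ _ _ _ _ _ uS u'S loc loc'.
have uu' : u = u' by rewrite -(vtxE k l u) -(vtxE k l u') rowE colE slotE.
split=> //; subst u' e'; move: tgt; rewrite -tgt' => -[rE cE sE].
by rewrite -(vtxE k l v) -(vtxE k l v') rE cE sE.
Qed.

(** * The weighted graph, its planarity and its counts *)

Variable n : nat.

(** Row indices are below [n], so this serves as [T] for all targets at once. *)
Definition col_length := (rung l n * k + 3 * l.*2)%N.

Definition grid_adj (u v : 'I_n) := link k l b (minn u v) (maxn u v).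

Definition grid_wt (u v : 'I_n) : R :=
  (len k l col_length (minn u v) (maxn u v))%:R.

Let link_lt' u v : link k l b u v -> (u < v)%N.
Proof. exact: link_lt. Qed.

Lemma grid_adj_sym : symmetric grid_adj.
Proof. by move=> u v; rewrite /grid_adj minnC maxnC. Qed.

Lemma grid_adj_irr : irreflexive grid_adj.
Proof.
move=> u; apply/negP => /link_lt'.
by rewrite minnn maxnn ltnn.
Qed.

Lemma grid_wt_sym (u v : 'I_n) : grid_wt u v = grid_wt v u.
Proof. by rewrite /grid_wt minnC maxnC. Qed.

Lemma grid_wt_gt0 (u v : 'I_n) : grid_adj u v -> 0 < grid_wt u v.
Proof.
move=> uv; rewrite ltr0n (len_gt0 _ _ _ _ l_gt0 _ _ _ _ uv) //.
by rewrite /col_length; lia.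
Qed.

Definition grid : wgraph R n :=
  WGraph grid_adj_sym grid_adj_irr grid_wt_sym grid_wt_gt0.

Lemma edge_grid (u v : 'I_n) : edge grid u v -> link k l b u v.
Proof.
case/andP; rewrite /= /grid_adj => + uv.
by rewrite (minn_idPl (ltnW uv)) (maxn_idPr (ltnW uv)).
Qed.

Lemma grid_planar : planar grid.
Proof.
exists (fun v => place v), (fun u v => segment (place u) (place v)); split.
- by move=> u v /place_inj /val_inj.
- by move=> u v _; apply: continuous_subspaceT; exact: segment_continuous.
- move=> u v /edge_grid/link_lt' uv a a' _ _; apply: segment_inj.
  by apply/eqP => /place_inj uvE; rewrite uvE ltnn in uv.
- by move=> u v _; rewrite /segment subr0 !mul1r !mul0r !addr0 -surjective_pairing.
- by move=> u v _; rewrite /segment subrr !mul1r !mul0r !add0r -surjective_pairing.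
- by move=> u v x a /edge_grid uv; rewrite in_itv /=; exact: segment_place_notin.
move=> u v u' v' a a' /edge_grid uv /edge_grid u'v' ne.
rewrite !in_itv /= => a01 a'01 /(segments_disjoint _ _ _ _ _ _ uv u'v' a01 a'01)[uu' vv'].
by apply: ne; congr (_, _); exact: val_inj.
Qed.

(** [pot_at_link] tests tightness on edges only; this excludes [tight] pairs that are not edges. *)
Lemma tight_link i0 j0 m0 u v :
  tight l b i0 j0 m0 (row u) (col u) (slot u) (row v) (col v) (slot v) ->
  link k l b v u || link k l b u v.
Proof.
rewrite /tight /link; move: (row u) (col u) (slot u) (row v) (col v) (slot v).
move=> i j m i' j' m'; do 5?case/orP.
- by case/and4P=> /eqP -> /eqP -> ->; rewrite !eqxx.
- by case/and5P=> _ _ /eqP -> /eqP -> /andP[-> _]; rewrite !eqxx !orbT.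
- by case/and5P=> _ /eqP -> /eqP -> /eqP -> /andP[/eqP -> _]; rewrite !eqxx !orbT.
- by case/and5P=> _ /eqP -> /eqP -> /eqP -> /andP[/eqP -> _]; rewrite !eqxx !orbT.
- by case/and5P=> /eqP -> /eqP -> /eqP -> /eqP -> _; rewrite !eqxx !orbT.
- by case/and5P=> /eqP -> /eqP -> /eqP -> -> _; rewrite !eqxx !orbT.
Qed.

Lemma grid_adjE (u v : 'I_n) : grid_adj u v = link k l b u v || link k l b v u.
Proof.
have no_link i j : (i <= j)%N -> link k l b j i = false.
  by move=> ij; apply: contraTF ij => /link_lt'; rewrite -ltnNge.
rewrite /grid_adj; case: (ltngtP u v) => uv.
- by rewrite (no_link u v) ?orbF // ltnW.
- by rewrite (no_link v u) // ltnW.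
- by rewrite (val_inj uv) orbb.
Qed.

Lemma num_shortest_paths_grid (s t : 'I_n) : (row t <= row s)%N ->
  num_shortest_paths grid s t =
  num_tight l b (row t) (col t) (slot t) (row s) (col s) (slot s).
Proof.
move=> ts; pose D := pot_at k l col_length (row t) (col t) (slot t).
have tk := col_lt k l k_gt0 t; have tS := slot_lt _ l_gt0 t.
have T_ge : (rung l (row t) * k + 3 * l.*2 <= col_length)%N.
  rewrite leq_add2r leq_mul2r leq_mul2l ltnS.
  by rewrite (leq_trans (leq_row _ _ _)) ?orbT // ltnW.
have pot_link := pot_at_link _ _ b k_gt0 l_gt0 _ _ _ _ tk tS T_ge.
pose w (u v : 'I_n) := len k l col_length (minn u v) (maxn u v).
have adj_tight (u v : 'I_n) : adj grid u v ->
    (D u <= D v + w u v)%N /\ (D u == D v + w u v)%N =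
    tight l b (row t) (col t) (slot t) (row u) (col u) (slot u) (row v) (col v) (slot v).
  rewrite /= /grid_adj /w; case: (ltngtP u v) => uv.
  - by case/pot_link.
  - by case/pot_link.
  - by move/link_lt'; rewrite ltnn.
apply: (num_shortest_paths_potential _ _ _ _ w D
         (num_tight_at k l b (row t) (col t) (slot t))).
- by move=> u v _.
- by move=> u v /adj_tight[].
- by rewrite -[X in num_tight_at _ _ _ _ _ _ X](vtxE k l t) num_tight_at_target.
- move=> u ut.
  rewrite (num_tight_at_rec _ _ b k_gt0 l_gt0 _ _ _ _ tk tS T_ge n u) ?vtxE //.
  apply: eq_bigl => v; case: (boolP (adj grid u v)) => [/adj_tight[_ ->] //|/= nuv].
  by apply: contraNF nuv => /tight_link; rewrite grid_adjE orbC.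
by rewrite /num_tight_at num_tight_gt0.
Qed.

Lemma grid_bounded L : (3 * l - 1 <= L)%N -> bounded_count_planar L grid.
Proof.
move=> lL; split; first exact: grid_planar.
have le (s t : 'I_n) : (row t <= row s)%N -> (num_shortest_paths grid s t < 2 ^ L)%N.
  move=> ts; rewrite num_shortest_paths_grid //.
  apply: leq_trans (_ : 2 ^ (3 * l - 1) <= _)%N; last by rewrite leq_exp2l.
  by rewrite (num_tight_lt k) ?slot_lt ?col_lt.
move=> s t; case: (leqP (row t) (row s)) => [/le//|/ltnW/le].
by rewrite num_shortest_paths_sym.
Qed.

Lemma num_shortest_paths_corner (s t : 'I_n) i j r :
  (j.+1 < k)%N -> (i < r)%N -> t = vtx k l i 0 0 :> nat -> s = vtx k l r j.+1 0 :> nat ->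
  num_shortest_paths grid s t = (bits (b i j) l + 2 ^ l.-1)%N.
Proof.
move=> jk ir tE sE; have S0 : (0 < l.*2)%N by rewrite double_gt0.
have [rt ct st] := vtxK _ _ k_gt0 l_gt0 i _ _ k_gt0 S0; rewrite -tE in rt ct st.
have [rs cs ss] := vtxK _ _ k_gt0 l_gt0 r _ _ jk S0; rewrite -sE in rs cs ss.
rewrite num_shortest_paths_grid rt rs ?(ltnW ir) // ct cs st ss -fan_count_bits //.
rewrite /num_tight /gate ltnNge (ltnW ir) gtn_eqF //= chain_count_id muln1.
(* For [j = 0] the turn happens in the target's own cell, a separate branch of [gate]. *)
by case: j {jk sE cs} => [|j] /=; rewrite ?chain_count_id ?mul1n.
Qed.

End Drawing.

(** * Labels *)

Section EmptyGraph.
Variables (R : realType) (n : nat).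

Definition empty_graph : wgraph R n :=
  @WGraph R n (fun _ _ => false) (fun _ _ => 0) (fun _ _ => erefl)
    (fun _ => erefl) (fun _ _ => erefl) (fun _ _ uv => False_ind _ (notF uv)).

Lemma num_shortest_paths_empty (s t : 'I_n) :
  num_shortest_paths empty_graph s t = (s == t).
Proof.
case: (eqVneq s t) => [<-|st] /=.
  rewrite (@num_shortest_paths_potential _ _ _ _ (fun _ _ => 0%N) (fun _ => 0%N)
    (fun u => (u == s : nat)) _ _ _ _ s) ?eqxx //.
  by move=> u /negPf ->; rewrite big_pred0.
apply/eqP; rewrite cards_eq0; apply/eqP/setP => p; rewrite !inE.
apply/negP => /andP[/and3P[]]; case: (val p) => [|u q] //= _ _.
by rewrite (negPf st).
Qed.

Lemma empty_graph_bounded L : (0 < L)%N -> bounded_count_planar L empty_graph.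
Proof.
move=> L0; split; last first.
  move=> s t; rewrite num_shortest_paths_empty.
  by apply: leq_ltn_trans (leq_b1 _) _; rewrite -{1}(expn0 2) ltn_exp2l.
exists (fun v => (v%:R, 0)), (fun _ _ _ => (0, 0)); split=> //.
by move=> u v [/eqP]; rewrite eqr_nat => /eqP /val_inj.
Qed.

(* Counts are 1 on the diagonal and 0 elsewhere, so one constant label does not
   suffice. *)
Lemma nonempty_label L (label : wgraph R n -> 'I_n -> seq bool) decode :
  (1 < n)%N -> (0 < L)%N -> counting_scheme L label decode ->
  exists v, (0 < size (label empty_graph v))%N.
Proof.
move=> n1 L0 /(_ _ (empty_graph_bounded _ L0)) dec; apply: contrapT => no_label.
have lab0 v : label empty_graph v = [::].
  apply/eqP; rewrite -size_eq0 -leqn0 leqNgt; apply/negP => v0.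
  by apply: no_label; exists v.
pose v0 := Ordinal (ltnW n1); pose v1 := Ordinal n1.
have := dec v0 v1; have := dec v0 v0; rewrite !lab0 !num_shortest_paths_empty => ->.
by rewrite eqxx.
Qed.

End EmptyGraph.

Section Encoding.
Variables (B : nat).

(** The appended [true] marks the end of the label, so that filling up with [false] stays
    injective. *)
Definition pad (s : seq bool) : B.-tuple bool :=
  [tuple nth false (rcons s true) i | i < B].

Lemma pad_inj s s' : (size s < B)%N -> (size s' < B)%N -> pad s = pad s' -> s = s'.
Proof.
have nthE r r' i : pad r = pad r' -> (i < B)%N ->
    nth false (rcons r true) i = nth false (rcons r' true) i.
  move=> E iB; have := congr1 (fun t : B.-tuple bool => tnth t (Ordinal iB)) E.
  by rewrite !tnth_mktuple.
have szle r r' : (size r < B)%N -> pad r = pad r' -> (size r <= size r')%N.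
  move=> rB E; rewrite leqNgt; apply/negP => lt.
  have := nthE _ _ _ E rB; rewrite nth_rcons ltnn eqxx nth_rcons.
  by rewrite ltnNge (ltnW lt) /= gtn_eqF.
move=> sB s'B E; have szE : size s = size s'.
  by apply/eqP; rewrite eqn_leq !szle.
apply: (@eq_from_nth _ false) => // i i_s.
by have := nthE _ _ i E (ltn_trans i_s sB); rewrite !nth_rcons -szE i_s.
Qed.

End Encoding.

Section Information.
Variables (R : realType) (n L q l : nat).
Hypotheses (q_gt0 : (0 < q)%N) (l_gt0 : (0 < l)%N).
Hypothesis n_ge : (q.+1 ^ 2 * l.*2 <= n)%N.
Hypothesis L_ge : (3 * l - 1 <= L)%N.

Let bit_table := {ffun 'I_q * 'I_q * 'I_l -> bool}.

Definition table_bit (f : bit_table) (i j x : nat) : bool :=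
  [exists e : 'I_q * 'I_q * 'I_l,
     [&& e.1.1 == i :> nat, e.1.2 == j :> nat, e.2 == x :> nat & f e]].

Lemma table_bitE f (i j : 'I_q) (x : 'I_l) : table_bit f i j x = f (i, j, x).
Proof.
apply/existsP/idP => [[[[i' j'] x']] /= /and4P[]|fe].
  by move=> /eqP/val_inj -> /eqP/val_inj -> /eqP/val_inj ->.
by exists (i, j, x); rewrite !eqxx.
Qed.

Let graph_of f := grid R q.+1 l (table_bit f) (ltn0Sn q) l_gt0 n.

Let vtx_lt i j : (i <= q)%N -> (j <= q)%N -> (vtx q.+1 l i j 0 < n)%N.
Proof.
move=> iq jq; apply: leq_trans n_ge; rewrite /vtx addn0 ltn_pmul2r ?double_gt0 //.
by rewrite -mulnn; nia.
Qed.

(** Every sink lies below and to the right of every source, so each pair reads off one cell. *)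
Let source (i : 'I_q) : 'I_n := Ordinal (vtx_lt i 0 (ltnW (ltn_ord i)) (leq0n q)).
Let sink (j : 'I_q) : 'I_n := Ordinal (vtx_lt q j.+1 (leqnn q) (ltn_ord j)).

(** If all labels were shorter than [B], the padded labels of sources and sinks would encode
    [q ^ 2 * l] free bits in [2 * q * B] bits. *)
Lemma large_label B (label : wgraph R n -> 'I_n -> seq bool) decode :
  (2 * B < q * l)%N -> counting_scheme L label decode ->
  exists G : wgraph R n, bounded_count_planar L G /\
    exists v, (B <= size (label G v))%N.
Proof.
move=> Bql dec; apply: contrapT => small.
have bnd f : bounded_count_planar L (graph_of f) by exact: grid_bounded.
have short f v : (size (label (graph_of f) v) < B)%N.
  rewrite ltnNge; apply/negP => vB; apply: small; exists (graph_of f).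
  by split=> //; exists v.
pose code f := ([ffun i => pad B (label (graph_of f) (source i))],
                [ffun j => pad B (label (graph_of f) (sink j))]).
have code_inj : injective code.
  move=> f g [/ffunP srcE /ffunP snkE]; apply/ffunP => -[[i j] x].
  rewrite -!table_bitE; apply: (@bits_inj _ _ l) => //.
  have cornerE h : num_shortest_paths (graph_of h) (sink j) (source i) =
      (bits (table_bit h i j) l + 2 ^ l.-1)%N.
    exact (num_shortest_paths_corner R q.+1 l (table_bit h) (ltn0Sn q) l_gt0 n
      (sink j) (source i) i j q (ltn_ord j) (ltn_ord i) erefl erefl).
  apply/eqP; rewrite -(eqn_add2r (2 ^ l.-1)) -!cornerE -!dec //.
  have := srcE i; have := snkE j; rewrite !ffunE.
  by move=> /pad_inj -> // /pad_inj -> //.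
have := leq_card _ code_inj.
rewrite card_prod !card_ffun !card_prod !card_tuple !card_ord card_bool.
by rewrite -!expnM -expnD leq_exp2l //; nia.
Qed.

End Information.

(** The largest grid that fits; the hypothesis admits [q = 1], and maximality bounds [n] from
    above. *)
Lemma grid_size_exists n l : (0 < l)%N -> (8 * l <= n)%N ->
  exists2 q, (0 < q)%N & (q.+1 ^ 2 * l.*2 <= n < q.+2 ^ 2 * l.*2)%N.
Proof.
move=> l0 ln; pose P q := (q.+1 ^ 2 * l.*2 <= n)%N.
have P1 : P 1%N by rewrite /P; lia.
have Pn q : P q -> (q <= n)%N.
  by rewrite /P => h; apply: leq_trans h; rewrite -mulnn; nia.
case: (ex_maxnP (ex_intro (fun q => is_true (P q)) 1%N P1) Pn) => q Pq q_max.
exists q; first exact: q_max.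
by rewrite -/(P q) Pq /= ltnNge; apply/negP => /q_max; rewrite ltnn.
Qed.

Theorem theorem4 (R : realType) (K : nat) :
  exists c : R, 0 < c /\
  forall n L : nat, (2 <= n)%N -> (2 <= L)%N -> (L <= K * n)%N ->
  forall (label : wgraph R n -> 'I_n -> seq bool)
         (decode : seq bool -> seq bool -> nat),
    counting_scheme L label decode ->
    exists G : wgraph R n, bounded_count_planar L G /\
    exists v : 'I_n, c * Num.sqrt (n%:R * L%:R) <= (size (label G v))%:R.
Proof.
(* [68 = 17 * 4]: below, [n * L <= 18 * 16 * K.+1 * (q * l) ^ 2] with [18 * 16 <= 17 ^ 2], and
   [q * l <= 4 * M]. *)
pose C := (68 * K.+1)%N; exists C%:R^-1; split; first by rewrite invr_gt0 ltr0n.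
move=> n L n2 L2 LKn label decode dec.
suff [M nL [G [Gb [v Mv]]]] : exists2 M, (n * L <= (C * M) ^ 2)%N &
    exists G : wgraph R n, bounded_count_planar L G /\
      exists v, (M <= size (label G v))%N.
  exists G; split=> //; exists v.
  rewrite mulrC ler_pdivrMr ?ltr0n // [leRHS]mulrC -[in leRHS]natrM.
  apply: (@le_trans _ _ ((C * M)%:R)); last by rewrite ler_nat leq_mul2l Mv orbT.
  rewrite -[leRHS]ger0_norm ?ler0n // -sqrtr_sqr -natrX.
  by rewrite ler_wsqrtr // -natrM ler_nat.
have label1 : exists G : wgraph R n, bounded_count_planar L G /\
    exists v, (1 <= size (label G v))%N.
  have L0 : (0 < L)%N by exact: ltnW.
  exists (empty_graph R n); split; first exact: empty_graph_bounded.
  exact: nonempty_label dec.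
(* The smallest grid needs 8 vertices; below that [L <= K * n] bounds [n * L], and one bit
   suffices. *)
have [n8|n8] := ltnP n 8.
  exists 1%N => //; apply: (@leq_trans (7 * (K * 7))); last first.
    by rewrite /C muln1 -mulnn; nia.
  have n7 : (n <= 7)%N by rewrite -ltnS.
  by apply: leq_mul => //; apply: leq_trans LKn _; rewrite leq_mul2l n7 orbT.
(* The largest [l] with [3 * l - 1 <= L] and [8 * l <= n]. *)
pose l := minn (L.+1 %/ 3) (n %/ 8).
have l_gt0 : (0 < l)%N by rewrite /l; lia.
have lL : (3 * l - 1 <= L)%N by rewrite /l; lia.
have Ll : (L <= 16 * K.+1 * l)%N.
  rewrite /l; case: (leqP (L.+1 %/ 3) (n %/ 8)) => _; first by nia.
  have n16 : (n <= 16 * (n %/ 8))%N by lia.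
  by apply: leq_trans LKn _; move: (n %/ 8)%N n16 => d; nia.
have [q q_gt0 /andP[n_ge n_lt]] : exists2 q, (0 < q)%N &
    (q.+1 ^ 2 * l.*2 <= n < q.+2 ^ 2 * l.*2)%N.
  by apply: grid_size_exists; rewrite ?/l; lia.
(* [q.+2 <= 3 * q] as [q] is positive. *)
have nle : (n <= 18 * q ^ 2 * l)%N by move: n_lt; rewrite -!mulnn -muln2; nia.
have bound M : (q * l <= 4 * M)%N -> (n * L <= (C * M) ^ 2)%N.
  move=> qlM; apply: (@leq_trans (18 * q ^ 2 * l * (16 * K.+1 * l))).
    exact: leq_mul.
  apply: (@leq_trans ((17 * K.+1 * (q * l)) ^ 2)).
    by rewrite -!mulnn; nia.
  by rewrite leq_exp2r // /C; nia.
have [ql4|ql4] := leqP (q * l) 4; first by exists 1%N => //; exact: bound.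
(* The largest [M] with [2 * M < q * l]; it can vanish for small [q * l], hence the case before. *)
exists ((q * l).-1 %/ 2)%N; first by apply: bound; lia.
by apply: (large_label R n L q l _ _ n_ge lL) dec; lia.
Qed.
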